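(* For all integers $n\ge 4$, we have $\mathrm{ID}(n)\le\lfloor\frac n2\rfloor$. Moreover, $\mathrm{ID}(3)=1$, $\mathrm{ID}(4)=\mathrm{ID}(5)=2$, $\mathrm{ID}(6)=\mathrm{ID}(7)=\mathrm{ID}(8)=3$, and $\mathrm{ID}(n)\ge 3$ for all $n\ge 9$.
   Context: Let $X$ be a finite set with $|X|\ge 3$. A split of $X$ is an unordered bipartition $A|B=B|A$ of $X$ into two non-empty disjoint subsets (its parts) with $A\cup B=X$. It is trivial if one of its parts has size 1. A split system on $X$ is a set $\mathcal S$ of splits of $X$ that contains all trivial splits $\{x\}|X-\{x\}$, $x\in X$. For $S\in\mathcal S$ and $x\in X$, $S(x)$ denotes the part of $S$ containing $x$. The Buneman graph $\mathcal B(\mathcal S)$ has as vertices all maps $\phi:\mathcal S\to\mathcal P(X)$ such that (B1) $\phi(S)\in S$ for all $S\in\mathcal S$, and (B2) $\phi(S)\cap\phi(S')\ne\emptyset$ for all distinct $S,S'\in\mathcal S$. Two vertices $\phi,\phi'$ are adjacent if there is a unique $S\in\mathcal S$ with $\phi(S)\neq\phi'(S)$. For $x\in X$, $\phi_x$ denotes the vertex $S\mapsto S(x)$. It is known that $\mathcal B(\mathcal S)$ is a median graph, i.e. it is connected and any three vertices $u,v,w$ have a unique median (a vertex lying on shortest paths between each pair of $u,v,w$). For $Y=\{x,y,z\}\in\binom X3$, $\phi_Y$ denotes the median of $\phi_x,\phi_y,\phi_z$ in $\mathcal B(\mathcal S)$. The split system $\mathcal S$ is injective if $\phi_Y\ne\phi_{Y'}$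 for all distinct $Y,Y'\in\binom X3$. Two distinct splits $A|B$ and $C|D$ of $X$ are incompatible if $A\cap C$, $A\cap D$, $B\cap C$, $B\cap D$ are all non-empty. A set of splits is incompatible if any two distinct splits in it are incompatible. The dimension $\dim(\mathcal S)$ is the dimension of the largest hypercube contained in $\mathcal B(\mathcal S)$ (and 1 if $\mathcal B(\mathcal S)$ is a tree); equivalently (known), it is the maximum size of an incompatible subset of $\mathcal S$. For $n\ge 3$, the injective dimension is $\mathrm{ID}(n)=\min\{\dim(\mathcal S):\mathcal S\text{ is an injective split system on }\{1,\dots,n\}\}$. *)

(* Defs.v *)
From HB Require Import structures.
From mathcomp Require Import all_boot.
From mathcomp Require Import boolp.

Set Implicit Arguments.
Unset Strict Implicit.
Unset Printing Implicit Defensive.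

Section Graphs.
Variables (V : finType) (e : rel V).

Definition geodesic (u v : V) (p : seq V) : Prop :=
  [/\ path e u p, last u p = v
    & forall q, path e u q -> last u q = v -> size p <= size q].

Definition on_geodesic (u v m : V) : Prop :=
  exists2 p, geodesic u v p & m \in u :: p.

Definition is_median (u v w m : V) : Prop :=
  [/\ on_geodesic u v m, on_geodesic u w m & on_geodesic v w m].

(* The default value [u] is never used in a Buneman graph: see [medianP]. *)
Definition median (u v w : V) : V :=
  odflt u [pick m | `[< is_median u v w m >]].

(* The [k]-dimensional hypercube has the 0-1 vectors of length [k] as vertices,
   two of them being adjacent when they differ in exactly one coordinate; it
   only has to occur as a (not necessarily induced) subgraph. *)
Definition contains_hypercube (k : nat) : Prop :=
  exists f : {ffun 'I_k -> bool} -> V,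
    injective f /\
    forall a b : {ffun 'I_k -> bool}, #|[set i | a i != b i]| = 1 -> e (f a) (f b).

(* The bound on [k] is harmless: see [contains_hypercube_leq]. *)
Definition hypercube_dim : nat :=
  \max_(k < #|V| | `[< contains_hypercube k >]) k.

Lemma contains_hypercube_ltn k : contains_hypercube k -> k < #|V|.
Proof.
case=> f [injf _]; have := leq_card f injf.
by rewrite card_ffun card_bool card_ord; apply: leq_trans (ltn_expl _ _).
Qed.

Lemma contains_hypercube_leq k : contains_hypercube k -> k <= hypercube_dim.
Proof.
move=> ck; have ltk := contains_hypercube_ltn ck.
by apply: (@leq_bigmax_cond _ _ _ (Ordinal ltk)); apply/asboolP.
Qed.

End Graphs.

Section Splits.
Variable T : finType.

Record bipart := Bipart {
  parts :> {set {set T}};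
  bipartP : partition parts [set: T] && (#|parts| == 2) }.

HB.instance Definition _ := [isSub for parts].
HB.instance Definition _ := [Finite of bipart by <:].

Definition part_of (S : bipart) (x : T) : {set T} := pblock S x.

Definition trivial_split (S : bipart) : bool := [exists A in parts S, #|A| == 1].

Definition split_system (SS : {set bipart}) : bool :=
  [forall S, trivial_split S ==> (S \in SS)].

Section Buneman.
Variable SS : {set bipart}.

Local Notation bmap := ({ffun {S : bipart | S \in SS} -> {set T}}).

Definition buneman_axiom (phi : bmap) : bool :=
  [forall S, phi S \in parts (val S)] &&
  [forall S, forall S', (S != S') ==> (phi S :&: phi S' != set0)].

Record bvertex := BVertex { bval :> bmap; bvertexP : buneman_axiom bval }.

HB.instance Definition _ := [isSub for bval].
HB.instance Definition _ := [Finite of bvertex by <:].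

Definition badj : rel bvertex := fun u v => #|[set S | u S != v S]| == 1.

Lemma cover_parts (S : bipart) : cover (parts S) = [set: T].
Proof. by case/andP: (bipartP S) => /and3P[/eqP]. Qed.

Lemma trivIset_parts (S : bipart) : trivIset (parts S).
Proof. by case/andP: (bipartP S) => /and3P[]. Qed.

Lemma part_of_mem (S : bipart) x : part_of S x \in parts S.
Proof. by apply: pblock_mem; rewrite cover_parts inE. Qed.

Lemma mem_part_of (S : bipart) x : x \in part_of S x.
Proof. by rewrite /part_of mem_pblock cover_parts inE. Qed.

Definition kuratowski_map (x : T) : bmap := [ffun S => part_of (val S) x].

Lemma kuratowski_subproof x : buneman_axiom (kuratowski_map x).
Proof.
apply/andP; split; first by apply/forallP => S; rewrite ffunE part_of_mem.
apply/forallP => S; apply/forallP => S'; apply/implyP => _.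
by apply/set0Pn; exists x; rewrite !ffunE inE !mem_part_of.
Qed.

Definition kuratowski (x : T) : bvertex := BVertex (kuratowski_subproof x).

(* The vertex attached to the set [{x, y, z}]; the order does not matter since
   medians are symmetric. *)
Definition phi3 (x y z : T) : bvertex :=
  median badj (kuratowski x) (kuratowski y) (kuratowski z).

Definition injective_system : Prop :=
  forall x y z x' y' z' : T,
    #|[set x; y; z]| = 3 -> #|[set x'; y'; z']| = 3 ->
    [set x; y; z] != [set x'; y'; z'] -> phi3 x y z <> phi3 x' y' z'.

(* When [3 <= #|T|] the graph of a split system has an edge ([dim_gt0]), so
   that this is 1 if the graph is a tree. *)
Definition dim : nat := hypercube_dim badj.

Definition dset (u v : bvertex) := [set S | u S != v S].

Lemma dsetC u v : dset u v = dset v u.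
Proof. by apply/setP => S; rewrite !inE eq_sym. Qed.

Lemma vertex_mem (u : bvertex) S : u S \in parts (val S).
Proof. by case/andP: (bvertexP u) => /forallP. Qed.

Lemma vertex_meet (u : bvertex) S S' : S != S' -> u S :&: u S' != set0.
Proof.
by case/andP: (bvertexP u) => _ /forallP/(_ S)/forallP/(_ S')/implyP; apply.
Qed.

Lemma partsE (S : bipart) A : A \in parts S -> parts S = [set A; ~: A].
Proof.
have /andP[/and3P[/eqP cov /trivIsetP tr n0] /cards2P [B [C [neBC eqS]]]] := bipartP S.
have tBC : [disjoint B & C] by apply: tr => //; rewrite eqS !inE eqxx ?orbT.
have eC : C = ~: B.
  apply/setP => x; have := in_setT x; rewrite -cov eqS /cover.
  rewrite bigcup_setU !big_set1 !inE.
  case xB: (x \in B) => /=; last by move->.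
  move=> _; apply/negP => xC; move/pred0P/(_ x): tBC; by rewrite /= xB xC.
by rewrite eqS eC !inE => /orP[]/eqP-> //; rewrite setCK setUC.
Qed.

Lemma vertex_diff (u v : bvertex) S : u S != v S -> v S = ~: u S.
Proof.
move=> ne; have := vertex_mem v S; rewrite (partsE (vertex_mem u S)) !inE.
by rewrite eq_sym (negPf ne) => /eqP.
Qed.

Lemma vertex_eqP (u v : bvertex) : (forall S, u S = v S) -> u = v.
Proof. by move=> e; apply/val_inj/ffunP. Qed.

Lemma dset0 u v : dset u v = set0 -> u = v.
Proof.
move=> e; apply: vertex_eqP => S; apply/eqP/negPn/negP => ne.
by have := in_set0 S; rewrite -e inE ne.
Qed.

Lemma flip_exists u v : u != v ->
  exists w, badj u w /\ #|dset w v| < #|dset u v|.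
Proof.
move=> neuv.
have [S1 hS1] : exists S1, S1 \in dset u v.
  by apply/set0Pn; apply: contra neuv => /eqP/dset0->.
case: (@arg_minnP _ S1 (fun S => S \in dset u v) (fun S => #|u S|) hS1) => S0 hS0 minS0.
have ne0 : u S0 != v S0 by move: hS0; rewrite inE.
have vC := vertex_diff ne0.
pose f : bmap := [ffun S => if S == S0 then v S0 else u S].
have key S' : S' != S0 -> v S0 :&: u S' != set0.
  move=> neS; apply/negP => e0.
  have sub : u S' \subset u S0.
    rewrite -[u S0]setCK -vC -disjoints_subset -setI_eq0.
    by rewrite setIC.
  case: (eqVneq (u S') (v S')) => [eS|dS].
    by have := vertex_meet v (S := S0) (S' := S'); rewrite -eS e0 eq_sym neS => /(_ isT).
  have /eqP eqS : u S' == u S0 by rewrite eqEcard sub minS0 // !inE.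
  case/eqP: neS; apply/val_inj/val_inj => /=.
  by rewrite (partsE (vertex_mem u S')) (partsE (vertex_mem u S0)) eqS.
have fP : buneman_axiom f.
  apply/andP; split.
    by apply/forallP => S; rewrite ffunE; case: eqP => [->|_]; apply: vertex_mem.
  apply/forallP => S; apply/forallP => S'; apply/implyP => neS; rewrite !ffunE.
  case: (S =P S0) neS => [->|_] neS.
    by move: neS; rewrite eq_sym => neS; rewrite (negPf neS) key.
  case: (S' =P S0) neS => [->|_] neS; last exact: vertex_meet.
  by rewrite setIC key.
exists (BVertex fP); split.
  apply/eqP; rewrite -(cards1 S0); congr #|pred_of_set _|.
  apply/setP => S; rewrite !inE ffunE.
  by case: (S =P S0) => [->|_]; rewrite ?ne0 ?eqxx.
apply: proper_card; rewrite properE; apply/andP; split.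
  apply/subsetP => S; rewrite !inE ffunE.
  by case: (S =P S0) => [->|//]; rewrite eqxx.
by apply/subsetPn; exists S0; rewrite // inE ffunE !eqxx.
Qed.

Lemma dset_triangle u v w : dset u w \subset dset u v :|: dset v w.
Proof.
apply/subsetP => S; rewrite !inE => ne.
by case: (eqVneq (u S) (v S)) => //= <-.
Qed.

Lemma dset_leq u v w : #|dset u w| <= #|dset u v| + #|dset v w|.
Proof.
by apply: leq_trans (subset_leq_card (dset_triangle u v w)) (leq_card_setU _ _).
Qed.

Lemma path_dset u p : path badj u p -> #|dset u (last u p)| <= size p.
Proof.
elim: p u => [|w p IH] u /=.
  by move=> _; rewrite leqn0 cards_eq0; apply/eqP/setP => S; rewrite !inE eqxx.
case/andP=> /eqP uw pw; apply: leq_trans (dset_leq u w _) _.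
by rewrite /dset uw add1n ltnS; apply: IH.
Qed.

Lemma path_exists u v :
  exists p, [/\ path badj u p, last u p = v & size p = #|dset u v|].
Proof.
move: {2}_.+1 (ltnSn #|dset u v|) => n; elim: n u => // n IH u ltn.
case: (eqVneq u v) => [->|ne].
  exists [::]; split=> //=.
  by apply/esym/eqP; rewrite cards_eq0; apply/eqP/setP => S; rewrite !inE eqxx.
have [w [uw ltw]] := flip_exists ne.
have [p [pp lp sp]] := IH w (leq_trans ltw ltn).
exists (w :: p); split=> /=; rewrite ?uw //.
apply/eqP; rewrite eqn_leq sp ltw /=.
by have := dset_leq u w v; rewrite {2}/dset (eqP uw) add1n.
Qed.

Lemma on_geodesicP u v m :
  on_geodesic badj u v m <-> #|dset u m| + #|dset m v| = #|dset u v|.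
Proof.
split.
  case=> p [pp lp minp] mp.
  have [q [pq lq sq]] := path_exists u v.
  have := minp q pq lq; rewrite sq.
  case/splitPl: mp pp lp {minp} => p1 p2 lp1; rewrite cat_path last_cat lp1 => /andP[pp1 pp2] lp2.
  rewrite size_cat => le; apply/eqP; rewrite eqn_leq dset_leq andbT.
  apply: leq_trans le; rewrite leq_add //; first by rewrite -lp1 path_dset.
  by rewrite -lp2 path_dset.
move=> e.
have [p [pp lp sp]] := path_exists u m; have [q [pq lq sq]] := path_exists m v.
exists (p ++ q).
  split; rewrite ?cat_path ?last_cat ?lp ?pp //.
  by move=> r pr lr; rewrite size_cat sp sq e -lr path_dset.
by rewrite -cat_cons mem_cat -lp mem_last.
Qed.

Lemma on_geodesic_split u v m :
  on_geodesic badj u v m <-> forall S, u S = v S -> m S = u S.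
Proof.
rewrite on_geodesicP; split=> [e S euv|h].
  apply/esym/eqP/negPn/negP => ne.
  have : #|dset u v| < #|dset u m| + #|dset m v|.
    rewrite -cardsUI -addn1 leq_add //.
      exact: subset_leq_card (dset_triangle u m v).
    rewrite card_gt0; apply/set0Pn; exists S; by rewrite !inE -euv ne eq_sym ne.
  by rewrite e ltnn.
rewrite -cardsUI; have -> : dset u m :&: dset m v = set0.
  apply/setP => S; rewrite !inE; apply/negP => /andP[n1 n2].
  case: (eqVneq (u S) (v S)) => [/h E|ne]; first by rewrite E eqxx in n1.
  move: n2; rewrite (vertex_diff n1) (vertex_diff ne) eqxx //.
rewrite cards0 addn0; congr #|pred_of_set _|; apply/eqP.
rewrite eqEsubset dset_triangle andbT; apply/subsetP => S; rewrite !inE.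
case: (eqVneq (u S) (v S)) => // E; by rewrite (h S E) -E eqxx.
Qed.

Definition majority_map (u v w : bvertex) : bmap :=
  [ffun S => if u S == v S then u S else w S].

Lemma majority_subproof u v w : buneman_axiom (majority_map u v w).
Proof.
apply/andP; split.
  by apply/forallP => S; rewrite ffunE; case: eqP => _; apply: vertex_mem.
apply/forallP => S; apply/forallP => S'; apply/implyP => ne; rewrite !ffunE.
case: (u S =P v S) => [e|/eqP d]; case: (u S' =P v S') => [e'|/eqP d'];
  try exact: vertex_meet.
  case: (eqVneq (u S') (w S')) => [<-|n]; first exact: vertex_meet.
  by rewrite (vertex_diff n) -(vertex_diff d') e vertex_meet.
case: (eqVneq (u S) (w S)) => [<-|n]; first exact: vertex_meet.
by rewrite (vertex_diff n) -(vertex_diff d) e' vertex_meet.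
Qed.

Definition majority u v w : bvertex := BVertex (majority_subproof u v w).

Lemma majorityP u v w : is_median badj u v w (majority u v w).
Proof.
split; apply/on_geodesic_split => S e; rewrite ffunE.
- by rewrite e eqxx.
- by case: eqP.
- by rewrite -e; case: eqP.
Qed.

Lemma median_uniq u v w m : is_median badj u v w m -> m = majority u v w.
Proof.
case=> /on_geodesic_split uv /on_geodesic_split uw /on_geodesic_split vw.
apply: vertex_eqP => S; rewrite ffunE; case: eqP => [/uv //|/eqP d].
case: (eqVneq (u S) (w S)) => [e|n]; first by rewrite uw.
by rewrite vw (vertex_diff d) ?(vertex_diff n).
Qed.

Lemma medianE u v w : median badj u v w = majority u v w.
Proof.
rewrite /median; case: pickP => [m /asboolP/median_uniq //|/(_ (majority u v w))].
by move/asboolP; case; exact: majorityP.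
Qed.

Lemma medianP u v w m : is_median badj u v w m <-> m = median badj u v w.
Proof.
by rewrite medianE; split=> [/median_uniq|->] //; exact: majorityP.
Qed.

Lemma badj_connected u v : exists2 p, path badj u p & last u p = v.
Proof. by have [p [pp lp _]] := path_exists u v; exists p. Qed.

End Buneman.

Lemma mk_bipart (A : {set T}) : A != set0 -> ~: A != set0 ->
  exists S : bipart, parts S = [set A; ~: A].
Proof.
move=> A0 AC0.
have neA : A != ~: A.
  apply/eqP => e; case/set0Pn: A0 => x xA.
  by move: (xA); rewrite e inE xA.
suff P : partition [set A; ~: A] [set: T] && (#|[set A; ~: A]| == 2).
  by exists (Bipart P).
rewrite cards2 neA andbT; apply/and3P; split.
- by rewrite /cover bigcup_setU !big_set1 setUCr.
- apply/trivIsetP => B C; rewrite !inE => /orP[]/eqP-> /orP[]/eqP->;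
    rewrite ?eqxx // -setI_eq0 ?setICr // setIC setICr //.
- by rewrite !inE !(eq_sym set0) negb_or A0 AC0.
Qed.

Lemma dim_gt0 (SS : {set bipart}) : split_system SS -> 3 <= #|T| -> 0 < dim SS.
Proof.
move=> /forallP sys T3.
have /card_gt1P[x [y [_ _ nexy]]] : 1 < #|T| by apply: leq_trans T3.
have [||S0 eS] := @mk_bipart [set x].
- by apply/set0Pn; exists x; rewrite inE.
- by apply/set0Pn; exists y; rewrite !inE eq_sym.
have xS : [set x] \in parts S0 by rewrite eS !inE eqxx.
have S0in : S0 \in SS.
  by apply: (implyP (sys S0)); apply/existsP; exists [set x]; rewrite xS cards1.
have ne : kuratowski SS x != kuratowski SS y.
  apply/eqP => /(congr1 (fun u : bvertex SS => u (exist _ S0 S0in))).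
  rewrite !ffunE /= => e.
  have := mem_part_of S0 y; rewrite -e /part_of.
  by rewrite (def_pblock (trivIset_parts S0) xS (set11 x)) inE eq_sym (negPf nexy).
have [w [xw _]] := flip_exists ne.
apply: (contains_hypercube_leq (k := 1)).
exists (fun a => if a ord0 then w else kuratowski SS x).
have nexw : kuratowski SS x != w.
  apply/eqP => e; move: xw; rewrite -e /badj.
  by rewrite (_ : [set S | _] = set0) ?cards0 //; apply/setP => S; rewrite !inE eqxx.
split.
  move=> a b; case ea: (a ord0); case eb: (b ord0) => e; try (by rewrite e eqxx in nexw);
    by apply/ffunP => i; rewrite (ord1 i) ea eb.
move=> a b /eqP/cards1P[i /setP/(_ ord0)]; rewrite !inE (ord1 i) eqxx.
case: (a ord0); case: (b ord0) => // _.
by rewrite /badj -[X in _ == X](eqP xw); apply/eqP; congr #|pred_of_set _|;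
  apply/setP => S; rewrite !inE eq_sym.
Qed.

Lemma setT_split_system : split_system [set: bipart].
Proof. by apply/forallP => S; rewrite inE implybT. Qed.

Lemma cards3_neq (x y z : T) : #|[set x; y; z]| = 3 -> [/\ x != y, x != z & y != z].
Proof.
rewrite setUC cardsU1 cards2 !inE negb_or.
by rewrite (eq_sym z x) (eq_sym z y); case: (x == y); case: (x == z); case: (y == z).
Qed.

Lemma setT_injective : injective_system [set: bipart].
Proof.
move=> x y z x' y' z' c3 c3' neY.
have [c cY cY'] : exists2 c, c \in [set x; y; z] & c \notin [set x'; y'; z'].
  apply/subsetPn; apply: contra neY => sub.
  by rewrite eqEcard sub c3 c3'.
have [a aY neac] : exists2 a, a \in [set x; y; z] & a != c.
  have : 1 < #|[set x; y; z]| by rewrite c3.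
  case/card_gt1P => a [b [aY bY nab]].
  case: (eqVneq a c) => [e|n]; last by exists a.
  by exists b; rewrite // -e eq_sym.
pose A := [set a; c].
have [||S eS] := @mk_bipart A.
- by apply/set0Pn; exists a; rewrite !inE eqxx.
- rewrite -card_gt0 cardsCs setCK subn_gt0 cards2 neac /=.
  by apply: leq_trans (max_card (mem [set x; y; z])); rewrite c3.
have Sin : S \in [set: bipart] by rewrite inE.
have AS : A \in parts S by rewrite eS !inE eqxx.
have CS : ~: A \in parts S by rewrite eS !inE eqxx orbT.
have pE t : part_of S t = if t \in A then A else ~: A.
  case tA: (t \in A); apply: def_pblock (trivIset_parts S) _ _ => //.
  by rewrite in_setC tA.
have neA : (A == ~: A) = false.
  by apply/eqP => /setP/(_ a); rewrite !inE eqxx.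
have phiE s t u : phi3 [set: bipart] s t u (exist _ S Sin) =
    if (s \in A) && (t \in A) || (u \in A) && ((s \in A) || (t \in A))
    then A else ~: A.
  rewrite /phi3 medianE /= !ffunE /= !pE.
  by case: (s \in A); case: (t \in A); case: (u \in A); rewrite ?eqxx ?neA 1?eq_sym ?neA.
move/(congr1 (fun v : bvertex [set: bipart] => v (exist _ S Sin))).
rewrite !phiE.
have -> : (x \in A) && (y \in A) || (z \in A) && ((x \in A) || (y \in A)).
  move: aY cY neac; rewrite !inE.
  by case/orP=> [/orP[]|] /eqP->; case/orP=> [/orP[]|] /eqP->; rewrite ?eqxx ?orbT.
have -> : (x' \in A) && (y' \in A) || (z' \in A) && ((x' \in A) || (y' \in A)) = false.
  have [] := cards3_neq c3'; move: cY'; rewrite !inE !negb_or => /andP[/andP[]].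
  rewrite !(eq_sym c) => /negPf-> /negPf-> /negPf->; rewrite !orbF.
  by case: (x' =P a) => [->|_]; case: (y' =P a) => [->|_];
    case: (z' =P a) => [->|_]; rewrite ?eqxx.
by move/eqP; rewrite neA.
Qed.

End Splits.

Definition attained_dim (n k : nat) : Prop :=
  exists SS : {set bipart 'I_n},
    [/\ split_system SS, injective_system SS & dim SS = k].

Lemma attained_dim_ex n : exists k, `[< attained_dim n k >].
Proof.
exists (dim [set: bipart 'I_n]); apply/asboolP; exists [set: bipart 'I_n].
by split; [exact: setT_split_system|exact: setT_injective|].
Qed.

(* The ground set {1, ..., n} is rendered as 'I_n = {0, ..., n-1}. *)
Definition ID (n : nat) : nat := ex_minn (attained_dim_ex n).

(* Main.v *)
Require Import Defs.
From mathcomp Require Import boolp.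
From mathcomp Require Import all_boot zify.

Set Implicit Arguments.
Unset Strict Implicit.
Unset Printing Implicit Defensive.

(* The dimension is the maximum size of a set of pairwise incompatible splits,
   and [phi_Y] sends a split to the part containing at least two points of [Y];
   so everything is about families of bipartitions separating 3-sets.

   Upper bound [n %/ 2]: take the splits with a part [i, j), i < j < n.
   Incompatible ones share no endpoint, so there are at most [n %/ 2] pairwise
   incompatible ones; two 3-sets with different middle points are separated by
   an initial segment, and otherwise by a segment with an end at the common
   middle point.  For n = 8 an explicit system of dimension 3 does better.

   Lower bounds: separating {a, b, c} from {a, b, d} takes a split that
   separates a from b and c from d.  For four
   points this yields two incompatible splits, and for six points an exhaustive
   search over the traces of the splits on these points always meets three
   pairwise incompatible ones. *)

(** * Dimension and incompatible splits *)

Definition incompat (T : finType) : rel (bipart T) := fun S S' =>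
  [forall A in parts S, forall B in parts S', A :&: B != set0].

Definition incompat_set (T : finType) (I : {set bipart T}) : bool :=
  [forall S in I, forall S' in I, (S != S') ==> incompat S S'].

Lemma incompatP (T : finType) (S S' : bipart T) :
  reflect {in parts S & parts S', forall A B, A :&: B != set0} (incompat S S').
Proof.
apply: (iffP forall_inP) => [h A B AS BS'|h A AS].
  by move/forall_inP: (h A AS); apply.
by apply/forall_inP => B; apply: h.
Qed.

Lemma incompat_setP (T : finType) (I : {set bipart T}) :
  reflect {in I &, forall S S', S != S' -> incompat S S'} (incompat_set I).
Proof.
apply: (iffP forall_inP) => [h S S' SI SI'|h S SI].
  by move/forall_inP: (h S SI) => /(_ S' SI')/implyP.
by apply/forall_inP => S' SI'; apply/implyP; apply: h.
Qed.

Lemma partsC (T : finType) (S : bipart T) A : A \in parts S -> ~: A \in parts S.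
Proof. by move/partsE => ->; rewrite !inE eqxx orbT. Qed.

Lemma parts_neq0 (T : finType) (S : bipart T) A : A \in parts S -> A != set0.
Proof.
case/andP: (bipartP S) => /and3P[_ _ n0] _ AS.
by apply: contraNneq n0 => <-.
Qed.

Lemma setC_neq (T : finType) (S : bipart T) A : A \in parts S -> (A == ~: A) = false.
Proof.
move=> AS; apply/eqP => e; case/set0Pn: (parts_neq0 AS) => x xA.
by move: (xA); rewrite e inE xA.
Qed.

Lemma parts2 (T : finType) (S : bipart T) A B :
  A \in parts S -> B \in parts S -> B = A \/ B = ~: A.
Proof. by move/partsE ->; rewrite !inE => /orP[]/eqP; [left|right]. Qed.

Lemma bipart_inj (T : finType) (S S' : bipart T) A :
  A \in parts S -> A \in parts S' -> S = S'.
Proof. by move=> AS AS'; apply: val_inj; rewrite /= (partsE AS) (partsE AS'). Qed.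

Lemma incompat_sym (T : finType) : symmetric (@incompat T).
Proof.
by move=> S S'; apply/incompatP/incompatP => h A B AS BS; rewrite setIC h.
Qed.

Lemma incompat_irr (T : finType) : irreflexive (@incompat T).
Proof.
move=> S; apply/incompatP => h.
have /andP[_ /cards2P[A [B [_ e]]]] := bipartP S.
have AS : A \in parts S by rewrite e !inE eqxx.
by have := h _ _ AS (partsC AS); rewrite setICr eqxx.
Qed.

Lemma incompat_part (T : finType) (S S' : bipart T) A B :
  A \in parts S -> B \in parts S' ->
  incompat S S' = [&& A :&: B != set0, A :&: ~: B != set0,
                      ~: A :&: B != set0 & ~: A :&: ~: B != set0].
Proof.
move=> AS BS; apply/incompatP/and4P => [h|[h1 h2 h3 h4] A' B' AS' BS'].
  by split; apply: h; rewrite ?partsC.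
by case: (parts2 AS AS') => ->; case: (parts2 BS BS') => ->.
Qed.

Section Cube.
Variables (T : finType) (SS : {set bipart T}).

(* Opposite edges of a square of the Buneman graph flip the same split. *)
Lemma square_label (u v w z : bvertex SS) s t :
  dset u v = [set s] -> dset u w = [set t] -> badj v z -> badj w z ->
  v != w -> u != z -> [/\ s != t, z s = v s & z t = w t].
Proof.
(* Flipping [x] twice in a row leads back to [a], so an edge from [b] to some [c] other than [a]
   leaves [x] alone. *)
have far (a b c : bvertex SS) x : dset a b = [set x] -> badj b c -> a != c -> c x = b x.
  move=> ab /cards1P[y bc] ac; apply/eqP; rewrite eq_sym; apply: contraNT ac => nex.
  have xy : x = y by have /setP/(_ x) := bc; rewrite !inE nex => /esym/eqP.
  apply/eqP/vertex_eqP => S; have /setP/(_ S) := ab; have /setP/(_ S) := bc.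
  rewrite !inE -xy; case: (S =P x) => [->|_].
    by move=> bcx abx; rewrite (vertex_diff bcx) (vertex_diff abx) setCK.
  by move/eqP=> -> /eqP.
move=> uv uw vz wz vw uz; split; [|exact: far uv vz uz|exact: far uw wz uz].
apply: contraNneq vw => st; apply/eqP/vertex_eqP => S.
have /setP/(_ S) := uv; have /setP/(_ S) := uw; rewrite -st !inE.
case: (S == s); first by move=> /vertex_diff-> /vertex_diff->.
by move/eqP=> <- /eqP.
Qed.

(** The splits are those flipped by the [k] edges at the origin [e0]. Any two of these edges span a
    square, and (B2) at its four vertices yields the four non-empty intersections. *)
Lemma hypercube_incompat k : contains_hypercube (@badj T SS) k ->
  exists I : {set bipart T}, [/\ I \subset SS, incompat_set I & #|I| = k].
Proof.
case=> f [injf adjf].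
pose e0 : {ffun 'I_k -> bool} := [ffun=> false].
pose e1 i : {ffun 'I_k -> bool} := [ffun j => j == i].
pose e2 i i' : {ffun 'I_k -> bool} := [ffun j => (j == i) || (j == i')].
have adj1 (a b : {ffun 'I_k -> bool}) i :
    (forall j, (a j != b j) = (j == i)) -> badj (f a) (f b).
  move=> h; apply: adjf; rewrite (_ : [set _ | _] = [set i]) ?cards1 //.
  by apply/setP => j; rewrite !inE h.
have /fin_all_exists[s sP] i : exists s, dset (f e0) (f (e1 i)) = [set s].
  by apply/cards1P; apply: (adj1 _ _ i) => j; rewrite !ffunE; case: (j == i).
have sq i j : i != j -> [/\ s i != s j, f (e2 i j) (s i) = f (e1 i) (s i)
                          & f (e2 i j) (s j) = f (e1 j) (s j)].
  move=> ij; apply: square_label (sP i) (sP j) _ _ _ _.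
  - apply: (adj1 _ _ j) => l; rewrite !ffunE.
    by case: (l =P i) => [->|_]; rewrite ?(negPf ij) //; case: (l == j).
  - apply: (adj1 _ _ i) => l; rewrite !ffunE.
    by case: (l =P j) => [->|_]; rewrite ?orbT ?orbF 1?eq_sym ?(negPf ij) //; case: (l == i).
  - by apply/eqP => /injf/ffunP/(_ i); rewrite !ffunE eqxx (negPf ij).
  - by apply/eqP => /injf/ffunP/(_ i); rewrite !ffunE eqxx.
have injs : injective s.
  by move=> i j e; apply/eqP/negPn/negP => /sq[]; rewrite e eqxx.
have valE i j : f (e1 i) (s j) = if j == i then ~: f e0 (s j) else f e0 (s j).
  have /setP/(_ (s j)) := sP i; rewrite !inE (inj_eq injs).
  case: (j == i); first exact: vertex_diff.
  by move/eqP.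
exists [set val (s i) | i in 'I_k]; split.
- by apply/subsetP => _ /imsetP[i _ ->]; apply: valP.
- apply/incompat_setP => _ _ /imsetP[i _ ->] /imsetP[j _ ->] nes.
  have ij : i != j by apply: contraNneq nes => ->.
  have [ss zi zj] := sq i j ij.
  rewrite (incompat_part (vertex_mem (f e0) (s i)) (vertex_mem (f e0) (s j))).
  have ji : (j == i) = false by rewrite eq_sym (negPf ij).
  (* The vertices [e2 i j], [e1 i], [e1 j] and [e0] realise the four choices of parts of [s i] and
     [s j]. *)
  have := vertex_meet (f (e2 i j)) ss; rewrite zi zj !valE !eqxx => ->.
  have := vertex_meet (f (e1 i)) ss; rewrite !valE !eqxx ji => ->.
  have := vertex_meet (f (e1 j)) ss; rewrite !valE !eqxx (negPf ij) => ->.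
  by rewrite vertex_meet.
- by rewrite card_imset ?card_ord //; apply: inj_comp val_inj injs.
Qed.

(** * From a maximal incompatible set to a hypercube *)

Section Maximal.
Variable M : {set bipart T}.
Hypothesis maxM : maxset (fun I : {set bipart T} => (I \subset SS) && incompat_set I) M.

(* Each split outside [M] has exactly one part meeting all parts of all members
   of [M]; these parts pairwise intersect, so fixing them and choosing freely on
   [M] gives the vertices of a cube. *)
Let big (S : bipart T) (B : {set T}) := [/\ B \in parts S,
  forall S' C, S' \in M -> C \in parts S' -> B :&: C != set0
  & exists S' C, [/\ S' \in M, C \in parts S' & C \subset B]].

Let inM : incompat_set M.
Proof. by case/maxsetP: maxM => /andP[]. Qed.

(** By maximality some [S'] in [M] is not incompatible with [S], so a part [A] of [S] misses a part
    [B] of [S']. The big part is [~: A], which contains [B]. *)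
Lemma big_exists S : S \in SS -> S \notin M -> exists B, big S B.
Proof.
move=> SSS SM; case/maxsetP: maxM => /andP[MSS _] max.
have [S' S'M nin] : exists2 S', S' \in M & ~~ incompat S S'.
  apply/exists_inP; apply: contraNT SM => /exists_inPn h.
  rewrite -(max (S |: M)) ?setU11 ?subsetUr // subUset sub1set SSS MSS /=.
  apply/incompat_setP => S1 S2 /setU1P[->|m1] /setU1P[->|m2]; rewrite ?eqxx // => ne.
  - by have := h S2 m2; rewrite negbK.
  - by have := h S1 m1; rewrite negbK incompat_sym.
  - exact: (incompat_setP _ inM).
have [A AS [B BS /negPn/eqP AB]] : exists2 A, A \in parts S &
    exists2 B, B \in parts S' & ~~ (A :&: B != set0).
  move/forall_inPn: nin => [A AS /forall_inPn[B BS h]]; exists A => //; by exists B.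
have BA : B \subset ~: A by rewrite subsetC -disjoints_subset -setI_eq0 AB.
exists (~: A); split; [exact: partsC| |by exists S', B].
(* If [~: A] missed [C], then [C] would lie in [A], hence be disjoint from [B]. Incompatibility
   within [M] forces [S2 = S'], then [C = ~: B = A], so [S] would be in [M]. *)
move=> S2 C m2 C2; apply/negP; rewrite setI_eq0 disjoints_subset setCS => AC.
have CB : C :&: B = set0.
  by apply/eqP; rewrite -subset0 -AB (setIC A) (setIC C) setIS.
have e2 : S2 = S'.
  apply/eqP/negPn/negP => /(incompat_setP _ inM _ _ m2 S'M)/incompatP/(_ C B C2 BS).
  by rewrite CB eqxx.
rewrite e2 in C2; case: (parts2 BS C2) => e.
  by move: (parts_neq0 BS); rewrite -(setIid B) -{1}e CB eqxx.
case/negP: SM; rewrite (_ : S = S') //; apply: (bipart_inj AS).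
suff -> : A = C by [].
by apply/eqP; rewrite eqEsubset AC andbT e subsetC.
Qed.

(** [B] contains a part of some member of [M], and [B'] meets that part. *)
Lemma big_meet S S' B B' : big S B -> big S' B' -> B :&: B' != set0.
Proof.
move=> [_ _ [R [C [RM CR CB]]]] [_ h _].
apply: contraNneq (h _ _ RM CR) => e.
by rewrite -subset0 -e setIC setSI.
Qed.

Lemma maximal_hypercube : contains_hypercube (@badj T SS) #|M|.
Proof.
case/maxsetP: (maxM) => /andP[MSS _] _.
(* On [M] the part is arbitrary and serves as the value at bit 0; elsewhere it is the big part, the
   same at all vertices of the cube. *)
have halfP (S : {S | S \in SS}) : exists B, (val S \in M -> B \in parts (val S)) /\
    (val S \notin M -> big (val S) B).
  case SM: (val S \in M); last first.
    by have [B Bbig] := big_exists (valP S) (negbT SM); exists B.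
  have /andP[_ /cards2P[A [B [_ e]]]] := bipartP (val S).
  by exists A; split=> // _; rewrite e !inE eqxx.
have {halfP}[half halfP] := fin_all_exists halfP.
pose bit (a : {ffun 'I_#|M| -> bool}) S := [exists i, (enum_val i == S) && a i].
have bitE a i : bit a (enum_val i) = a i.
  apply/existsP/idP => [[j /andP[/eqP/enum_val_inj->]] //|ai].
  by exists i; rewrite eqxx.
pose g a : {ffun {S | S \in SS} -> {set T}} :=
  [ffun S => if (val S \in M) && bit a (val S) then ~: half S else half S].
have gM a S : val S \in M -> g a S \in parts (val S).
  by move=> SM; rewrite ffunE; case: ifP => _; rewrite ?partsC ?(halfP S).1.
have gN a S : val S \notin M -> big (val S) (g a S).
  by move=> SM; rewrite ffunE (negPf SM) /=; apply: (halfP S).2.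
have gP a : buneman_axiom (g a).
  apply/andP; split; apply/forallP => S.
    by case SM: (val S \in M); [exact: gM|case: (gN a S (negbT SM))].
  apply/forallP => S'; apply/implyP => ne.
  have nv : val S != val S' by rewrite (inj_eq val_inj).
  case SM: (val S \in M); case SM': (val S' \in M).
  - by apply: (incompatP _ _ (incompat_setP _ inM _ _ SM SM' nv)); apply: gM.
  - by rewrite setIC; case: (gN a S' (negbT SM')) => _ h _; apply: (h _ _ SM); apply: gM.
  - by case: (gN a S (negbT SM)) => _ h _; apply: (h _ _ SM'); apply: gM.
  - exact: big_meet (gN a S (negbT SM)) (gN a S' (negbT SM')).
have gneq a b S : val S \in M -> (g a S != g b S) = (bit a (val S) != bit b (val S)).
  move=> SM; rewrite !ffunE SM /=; have hS := (halfP S).1 SM.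
  by case: (bit a _); case: (bit b _); rewrite ?eqxx // ?(eq_sym (~: _)) (setC_neq hS).
have vM (i : 'I_#|M|) : enum_val i \in M by apply: enum_valP.
have vSS (i : 'I_#|M|) : enum_val i \in SS by apply: (subsetP MSS).
pose vs i : {S | S \in SS} := exist (fun S => S \in SS) (enum_val i) (vSS i).
exists (fun a => BVertex (gP a)); split.
  move=> a b [e]; apply/ffunP => i; apply/eqP/negPn.
  rewrite -(bitE a) -(bitE b).
  by rewrite -(gneq a b (vs i)) ?(vM i) // e eqxx.
move=> a b /eqP/cards1P[i /setP ab]; apply/cards1P; exists (vs i).
apply/setP => S; rewrite !inE /=.
case SM: (val S \in M); last first.
  rewrite !ffunE SM eqxx; apply/esym/eqP => e.
  by move: SM; rewrite e /= (vM i).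
rewrite gneq // -val_eqE /= -(enum_rankK_in (vM i) SM) !bitE.
by have := ab (enum_rank_in (vM i) (val S)); rewrite !inE => ->; rewrite (inj_eq enum_val_inj).
Qed.

End Maximal.

(** The cube is built on a maximal incompatible set, so [I] is first extended to one. *)
Lemma incompat_leq_dim (I : {set bipart T}) : I \subset SS -> incompat_set I -> #|I| <= dim SS.
Proof.
move=> ISS inI; have [|M maxM IM] := @maxset_exists _ (fun I : {set bipart T} => (I \subset SS) && incompat_set I) I.
  by rewrite ISS.
apply: leq_trans (subset_leq_card IM) _.
exact: contains_hypercube_leq (maximal_hypercube maxM).
Qed.

Lemma dim_leq d : (forall I : {set bipart T}, I \subset SS -> incompat_set I -> #|I| <= d) -> dim SS <= d.
Proof.
move=> h; apply/bigmax_leqP => k /asboolP/hypercube_incompat[I [ISS inI <-]].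
exact: h.
Qed.

End Cube.

(** * Injectivity as separation of 3-sets *)

Lemma card_setI3 (T : finType) (A : {set T}) x y z : x != y -> x != z -> y != z ->
  #|A :&: [set x; y; z]| = (x \in A) + (y \in A) + (z \in A).
Proof.
move=> xy xz yz; rewrite setIC -sum1_card.
have -> : \sum_(t in [set x; y; z] :&: A) 1 = \sum_(t in [set x; y; z]) (t \in A).
  rewrite big_mkcond [RHS]big_mkcond; apply: eq_bigr => t _.
  by rewrite inE; do 2!case: (t \in _).
by rewrite -setUA big_setU1 ?inE ?negb_or ?xy //= big_setU1 ?inE //= big_set1 addnA.
Qed.

(** Medians are majorities at each split, and exactly one of [A] and [~: A] holds at least two of
    the three points. *)
Lemma phi3E (T : finType) (SS : {set bipart T}) (S : {S | S \in SS}) A x y z :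
  A \in parts (val S) -> #|[set x; y; z]| = 3 ->
  phi3 SS x y z S = if 1 < #|A :&: [set x; y; z]| then A else ~: A.
Proof.
move=> AS /cards3_neq[xy xz yz]; rewrite card_setI3 // /phi3 medianE /= !ffunE.
have pE t : part_of (val S) t = if t \in A then A else ~: A.
  case tA: (t \in A); apply: def_pblock (trivIset_parts _) _ _ => //.
    exact: partsC.
  by rewrite inE tA.
rewrite !pE; have := setC_neq AS.
by case: (x \in A); case: (y \in A); case: (z \in A) => h; rewrite ?eqxx ?h 1?eq_sym ?h.
Qed.

Lemma injective_systemP (T : finType) (SS : {set bipart T}) :
  injective_system SS <->
  (forall Y Y' : {set T}, #|Y| = 3 -> #|Y'| = 3 -> Y != Y' ->
    exists S A, [/\ S \in SS, A \in parts S
                  & (1 < #|A :&: Y|) != (1 < #|A :&: Y'|)]).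
Proof.
have set3P (Y : {set T}) : #|Y| = 3 -> exists x y z, Y = [set x; y; z].
  move=> cY; have [x xY] : exists x, x \in Y by apply/card_gt0P; rewrite cY.
  have /eqP/cards2P[y [z [_ e]]] : #|Y :\ x| = 2.
    by move: cY; rewrite (cardsD1 x) xY => -[].
  by exists x, y, z; rewrite -(setD1K xY) e setUA.
split=> [inj Y Y' cY cY' neY | sep x y z x' y' z' c c' ne e].
  have [x [y [z eY]]] := set3P Y cY; have [x' [y' [z' eY']]] := set3P Y' cY'.
  subst Y Y'; have nphi := inj _ _ _ _ _ _ cY cY' neY.
  have [S nS] : exists S, phi3 SS x y z S != phi3 SS x' y' z' S.
    apply/existsP; apply: contra_notT nphi => /existsPn h.
    by apply: vertex_eqP => S; apply/eqP/negPn/h.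
  have AS := vertex_mem (phi3 SS x y z) S.
  exists (val S), (phi3 SS x y z S); split=> //; first exact: valP.
  apply: contraNneq nS => e.
  by rewrite {1}(phi3E AS cY) (phi3E AS cY') e.
have [S [A [SSS AS]]] := sep _ _ c c' ne.
pose S' : {S | S \in SS} := exist (fun S => S \in SS) S SSS.
have := congr1 (fun v : bvertex SS => v S') e.
rewrite !(@phi3E _ SS S' A) //; have := setC_neq AS.
by case: (1 < _); case: (1 < _) => // h; [move/eqP|move/esym/eqP]; rewrite h.
Qed.

(** Replacing [c] by [d] changes the majority only if [A] contains exactly one of [c], [d] and the
    vote of [a], [b] is tied. *)
Lemma injective_quartet (T : finType) (SS : {set bipart T}) a b c d :
  injective_system SS -> uniq [:: a; b; c; d] ->
  exists S A, [/\ S \in SS, A \in parts S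
                & ((a \in A) != (b \in A)) && ((c \in A) != (d \in A))].
Proof.
move=> /injective_systemP sep.
rewrite /= !inE !negb_or => /and4P[/and3P[ab ac ad] /andP[bc bd] cd _].
have c3 x y z : x != y -> x != z -> y != z -> #|[set x; y; z]| = 3.
  by move=> xy xz yz; rewrite -(setTI [set x; y; z]) card_setI3 ?inE.
have [||| S [A [SSS AS]]] := sep [set a; b; c] [set a; b; d]; rewrite ?c3 //.
  apply/eqP => /setP/(_ c); rewrite !inE eqxx orbT.
  by rewrite !(eq_sym c) (negPf ac) (negPf bc) eq_sym (negPf cd).
rewrite !card_setI3 // => h; exists S, A; split=> //.
by move: h; do 4!case: (_ \in A).
Qed.

Lemma pairwise_incompat (T : finType) (ss : seq (bipart T)) :
  pairwise (@incompat T) ss ->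
  incompat_set [set S in ss] /\ #|[set S in ss]| = size ss.
Proof.
move=> pw; split; last first.
  by rewrite cardsE; apply/card_uniqP/(pairwise_uniq _ pw)/incompat_irr.
have : pairwise (fun S S' : bipart T => (S == S') || incompat S S') ss.
  by apply: sub_pairwise pw => S S' /= ->; rewrite orbT.
rewrite pairwise_all2rel; first last.
- by move=> S S'; rewrite eq_sym incompat_sym.
- by move=> S; rewrite eqxx.
move/allrelP => h; apply/incompat_setP => S S'; rewrite !inE => SI SI' ne.
by have := h _ _ SI SI'; rewrite (negPf ne).
Qed.

(** * Exhaustive search on few points *)

Definition code (T : finType) (xs : seq T) (A : {set T}) : bitseq :=
  [seq x \in A | x <- xs].

(** Incompatibility as seen on the listed points: crossing codes imply it for any list, while the
    converse is proved for the list of all points. *)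
Definition cross (b b' : bitseq) : bool :=
  let z := zip b b' in
  [&& has (fun u => u.1 && u.2) z, has (fun u => u.1 && ~~ u.2) z,
      has (fun u => ~~ u.1 && u.2) z & has (fun u => ~~ u.1 && ~~ u.2) z].

Lemma cross_incompat (T : finType) (S S' : bipart T) A B xs :
  A \in parts S -> B \in parts S' -> cross (code xs A) (code xs B) -> incompat S S'.
Proof.
move=> AS BS; rewrite (incompat_part AS BS) /cross zip_map !has_map.
case/and4P=> /hasP[x1 _ h1] /hasP[x2 _ h2] /hasP[x3 _ h3] /hasP[x4 _ h4].
apply/and4P; split; apply/set0Pn; [exists x1|exists x2|exists x3|exists x4];
  by rewrite !inE.
Qed.

Lemma incompat_cross (T : finType) (S S' : bipart T) A B :
  A \in parts S -> B \in parts S' -> incompat S S' ->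
  cross (code (enum T) A) (code (enum T) B).
Proof.
move=> AS BS; rewrite (incompat_part AS BS) /cross zip_map !has_map.
case/and4P=> /set0Pn[x1 h1] /set0Pn[x2 h2] /set0Pn[x3 h3] /set0Pn[x4 h4].
apply/and4P; split; apply/hasP; [exists x1|exists x2|exists x3|exists x4];
  by rewrite ?mem_enum // ?inE in h1 h2 h3 h4 *.
Qed.

Fixpoint has_clique (d : nat) (s : seq bitseq) : bool :=
  if d is d'.+1 then has (fun b => has_clique d' (filter (cross b) s)) s else true.

Lemma has_cliqueP d s :
  reflect (exists t, [/\ size t = d, {subset t <= s} & pairwise cross t]) (has_clique d s).
Proof.
elim: d s => [|d IH] s /=; first by left; exists [::].
apply: (iffP hasP) => [[b bs /IH[t [st ts pt]]]|[[|b t] [] // [st] ts /andP[bt pt]]].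
  exists (b :: t); split=> /=; first by rewrite st.
    by move=> c; rewrite inE => /predU1P[-> //|/ts]; rewrite mem_filter => /andP[].
  by rewrite pt andbT; apply/allP => c /ts; rewrite mem_filter => /andP[].
exists b; first by rewrite ts ?mem_head.
apply/IH; exists t; split=> // c ct; rewrite mem_filter (allP bt) //=.
by rewrite ts // inE ct orbT.
Qed.

Fixpoint bitseqs (m : nat) : seq bitseq :=
  if m is m'.+1 then [seq c :: b | c <- [:: true; false], b <- bitseqs m'] else [:: [::]].

Lemma mem_bitseqs b : b \in bitseqs (size b).
Proof.
by elim: b => // -[] b IH; rewrite /= mem_cat ?cats0 map_f ?orbT.
Qed.

(* The quartet [((i, j), (k, l))] asks for a split separating [i] from [j] and
   [k] from [l]. *)
Definition resolves (q : (nat * nat) * (nat * nat)) (b : bitseq) : bool :=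
  (nth false b q.1.1 != nth false b q.1.2) && (nth false b q.2.1 != nth false b q.2.2).

Definition pairs (m : nat) : seq (nat * nat) :=
  [seq (i, j) | i <- iota 0 m, j <- iota i.+1 (m - i.+1)].

(** The two pairs play symmetric roles, so the one with the smaller first point is put first. *)
Definition quartets (m : nat) : seq ((nat * nat) * (nat * nat)) :=
  [seq q <- [seq (p, p') | p <- pairs m, p' <- pairs m]
     | (q.1.1 < q.2.1) && uniq [:: q.1.1; q.1.2; q.2.1; q.2.2]].

Lemma mem_pairs m p : (p \in pairs m) = (p.1 < p.2 < m).
Proof.
case: p => i j; apply/allpairsPdep/andP => /= [[i' [j' []]]|[ij jm]].
  rewrite !mem_iota => im /andP[ij jm] [-> ->]; split=> //.
  by rewrite subnKC in jm.
have im := ltn_trans ij jm.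
by exists i, j; rewrite !mem_iota subnKC // ij jm im.
Qed.

(* Depth-first search: [ch] lists the codes assumed present, [cs] those not yet
   assumed absent.  Branching on the code resolving the first unresolved
   quartet, a code is assumed absent once its branch is closed. *)
Fixpoint refute (d : nat) (qs : seq ((nat * nat) * (nat * nat))) (ch cs : seq bitseq) : bool :=
  if qs is q :: qs' then
    if has (resolves q) ch then refute d qs' ch cs else
    (fix branch cand cs := if cand is b :: cand' then
       (if has_clique d (filter (cross b) ch) then true else refute d qs' (b :: ch) cs)
       && branch cand' (filter (predC1 b) cs)
     else true) (filter (resolves q) cs) cs
  else false.

(** [P] is the unknown set of codes present, kept between [ch] and [cs]. Some branch of the search
    follows [P]; it can close only on a code that forms a clique with [d] codes of [ch]. *)
Lemma refuteP d qs ch cs (P : pred bitseq) :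
  {in qs, forall q, exists2 b, P b & resolves q b} -> all P ch ->
  (forall b, P b -> b \in cs) -> refute d qs ch cs ->
  exists t, [/\ size t = d.+1, all P t & pairwise cross t].
Proof.
elim: qs ch cs => //= q qs IH ch cs hqs hch hcs.
have {}IH := IH _ _ (fun q' q'in => hqs q' (mem_behead (s := q :: qs) q'in)).
case: ifP => _; first exact: IH.
have [b0 Pb0 qb0] := hqs q (mem_head _ _).
have : b0 \in filter (resolves q) cs by rewrite mem_filter qb0 hcs.
move: (filter (resolves q) cs) => cand; elim: cand cs hcs => //= b cand IHc cs hcs b0in /andP[].
(* If [b] is absent, deleting it from [cs] keeps [P] inside [cs]. The loop cannot run out of
   candidates before meeting a member of [P], since [b0] is one. *)
case: (boolP (P b)) => [Pb|nPb _]; last first.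
  apply: IHc.
    by move=> c Pc; rewrite mem_filter hcs // andbT; apply: contraNneq nPb => <-.
  by move: b0in; rewrite inE => /predU1P[e|//]; rewrite -e Pb0 in nPb.
case: ifP => [/has_cliqueP[t [st ts pt]] _ _|_].
  exists (b :: t); split=> /=; first by rewrite st.
    rewrite Pb; apply/allP => c /ts.
    by rewrite mem_filter => /andP[_]; apply: (allP hch).
  by rewrite pt andbT; apply/allP => c /ts; rewrite mem_filter => /andP[].
by move=> ref _; apply: IH ref; rewrite //= Pb.
Qed.

(** Injectivity resolves every quartet of the listed points, and crossing traces lift to
    incompatible splits. A search on few points thus bounds the dimension on any larger set. *)
Lemma refute_dim (T : finType) (SS : {set bipart T}) d m x0 (xs : seq T) :
  injective_system SS -> uniq (x0 :: xs) -> size xs = m ->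
  refute d (quartets m.+1) [::] [seq true :: b | b <- bitseqs m] ->
  d < dim SS.
Proof.
move=> inj uxs sxs.
pose P b := [exists S in SS, exists A in parts S, (x0 \in A) && (b == code (x0 :: xs) A)].
have PP b : reflect (exists S A, [/\ S \in SS, A \in parts S, x0 \in A & b = code (x0 :: xs) A]) (P b).
  apply: (iffP exists_inP) => [[S SSS /exists_inP[A AS /andP[xA /eqP->]]]|[S [A [SSS AS xA ->]]]].
    by exists S, A.
  by exists S => //; apply/exists_inP; exists A; rewrite ?xA ?eqxx.
case/(@refuteP _ _ _ _ P) => // [q|b|t [st tP pt]].
- rewrite mem_filter => /andP[/andP[_ uq] /allpairsP[[p p'] /= []]].
  rewrite !mem_pairs => /andP[ij jm] /andP[kl lm] e; subst q => /=.
  pose x i := nth x0 (x0 :: xs) i.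
  have xE i A : i < m.+1 -> nth false (code (x0 :: xs) A) i = (x i \in A).
    by move=> im; rewrite (nth_map x0) //= sxs.
  have [im km] := (ltn_trans ij jm, ltn_trans kl lm).
  have /injective_quartet : uniq [:: x p.1; x p.2; x p'.1; x p'.2].
    have -> : [:: x p.1; x p.2; x p'.1; x p'.2] = [seq x i | i <- [:: p.1; p.2; p'.1; p'.2]] by [].
    have lt : {in [:: p.1; p.2; p'.1; p'.2], forall i, i < size (x0 :: xs)}.
      by apply/allP; rewrite /= sxs im jm km lm.
    rewrite map_inj_in_uniq // => i i' iin i'in /eqP.
    by rewrite nth_uniq ?lt // => /eqP.
  case/(_ _ inj) => S [A [SSS AS sep]].
  (* A split has two codes; the search only keeps the one starting with [true]. *)
  wlog x0A : A AS sep / x0 \in A.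
    move=> gen; case: (boolP (x0 \in A)) => [|x0A]; first exact: gen AS sep.
    apply: (gen (~: A)); rewrite ?partsC ?inE //.
    by move: sep; do 4!case: (_ \in A).
  exists (code (x0 :: xs) A); first by apply/PP; exists S, A.
  by rewrite /resolves /= !xE.
- case/PP=> S [A [_ _ x0A ->]].
  by rewrite /= x0A map_f // -sxs -(size_map (fun y => y \in A)) mem_bitseqs.
(* Choose for each code of the clique a split of [SS] and a part inducing it. *)
have [ps /allP psP et] : exists2 ps : seq (bipart T * {set T}),
    all (fun p => (p.1 \in SS) && (p.2 \in parts p.1)) ps
    & t = [seq code (x0 :: xs) p.2 | p <- ps].
  elim: t tP {st pt} => [|b t IH] /=; first by exists [::].
  case/andP=> /PP[S [A [SSS AS _ ->]]] /IH[ps psP ->].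
  by exists ((S, A) :: ps); rewrite //= SSS AS.
move: pt; rewrite et pairwise_map => pt.
have /pairwise_incompat[inc card] : pairwise (@incompat T) [seq p.1 | p <- ps].
  rewrite pairwise_map; apply: sub_in_pairwise pt; last exact/allP/psP.
  by move=> p p' /andP[_ pS] /andP[_ pS']; apply: cross_incompat.
rewrite -st et size_map -(size_map fst) -card.
apply: incompat_leq_dim inc; apply/subsetP => S; rewrite inE => /mapP[p pin ->].
by case/andP: (psP _ pin).
Qed.

(** * The segment system *)

Definition segment (n : nat) (i j : 'I_n) : {set 'I_n} := [set x : 'I_n | i <= x < j].

(** As [j] ranges over ['I_n], no segment holds the point [n - 1], and all ends of segments lie
    among [n] values. *)
Definition segment_system (n : nat) : {set bipart 'I_n} :=
  [set S | [exists i : 'I_n, exists j : 'I_n, (i < j) && (segment i j \in parts S)]].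

Lemma segment_systemP n (S : bipart 'I_n) :
  reflect (exists i j : 'I_n, i < j /\ segment i j \in parts S) (S \in segment_system n).
Proof.
rewrite inE; apply: (iffP existsP) => [[i /existsP[j /andP[]]]|[i [j [ij aS]]]].
  by exists i, j.
by exists i; apply/existsP; exists j; rewrite ij.
Qed.

Lemma segment_split n (i j : 'I_n) : i < j ->
  exists2 S, S \in segment_system n & segment i j \in parts S.
Proof.
move=> ij; have [||S eS] := @mk_bipart _ (segment i j).
- by apply/set0Pn; exists i; rewrite inE leqnn.
- by apply/set0Pn; exists j; rewrite !inE ltnn andbF.
have aS : segment i j \in parts S by rewrite eS !inE eqxx.
by exists S => //; apply/segment_systemP; exists i, j.
Qed.

Lemma split_system_segment n : split_system (segment_system n).
Proof.
apply/forallP => S; apply/implyP => /exists_inP[A AS /cards1P[x eA]].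
rewrite {}eA in AS; have n0 : 0 < n by apply: leq_ltn_trans (ltn_ord x).
apply/segment_systemP; case: (ltnP x.+1 n) => [xn|nx].
  exists x, (Ordinal xn); split=> //; suff -> : segment x (Ordinal xn) = [set x] by [].
  by apply/setP => y; rewrite !inE ltnS -eqn_leq eq_sym.
(* The last point is the complement of the segment from 0 to [x]; the other part of the split is
   non-empty, which gives [0 < x]. *)
have /set0Pn[y yx] := parts_neq0 (partsC AS).
exists (Ordinal n0), x; split=> /=.
  by move: yx (ltn_ord y); rewrite !inE -val_eqE /=; lia.
suff -> : segment (Ordinal n0) x = ~: [set x] by exact: partsC.
apply/setP => z; rewrite !inE /= -val_eqE ltn_neqAle andb_idr //.
by move=> _; rewrite -ltnS (leq_trans (ltn_ord z)).
Qed.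

Lemma sorted_set3 n (Y : {set 'I_n}) : #|Y| = 3 ->
  exists a b c : 'I_n, [/\ a < b, b < c & Y = [set a; b; c]].
Proof.
rewrite cardE => sY.
have : sorted (fun i j : 'I_n => i < j) (enum Y).
  rewrite /enum_mem -enumT; apply: sorted_filter; first by move=> i j k; apply: ltn_trans.
  have := iota_ltn_sorted 0 n; rewrite -val_enum_ord sorted_map.
  by apply: sub_sorted.
have := mem_enum Y; case: (enum Y) sY => [|a [|b [|c []]]] //= _ mY /and3P[ab bc _].
exists a, b, c; split=> //; apply/setP => x; rewrite -mY !inE orbA //.
Qed.

(** By convexity, a segment holding two of the points holds [a] and [b], or [b] and [c]. *)
Lemma card_segment3 n (i j a b c : 'I_n) : a < b -> b < c ->
  (1 < #|segment i j :&: [set a; b; c]|) = (i <= a) && (b < j) || (i <= b) && (c < j).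
Proof.
move=> ab bc; have ac := ltn_trans ab bc.
rewrite card_setI3 ?neq_ltn ?ab ?bc ?ac // !inE.
by lia.
Qed.

Lemma segment_separates n (a b c a' b' c' : 'I_n) :
  a < b -> b < c -> a' < b' -> b' < c' ->
  b < b' \/ b = b' :> nat /\ (a < a' \/ a = a' :> nat /\ c < c') ->
  exists i j : 'I_n, i < j /\
    (1 < #|segment i j :&: [set a; b; c]|) != (1 < #|segment i j :&: [set a'; b'; c']|).
Proof.
move=> ab bc ab' bc' lex.
suff [i [j [ij jn sep]]] : exists i j, [/\ i < j, j < n &
    ((i <= a) && (b < j) || (i <= b) && (c < j)) !=
    ((i <= a') && (b' < j) || (i <= b') && (c' < j))].
  by exists (Ordinal (ltn_trans ij jn)), (Ordinal jn); rewrite !card_segment3.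
have [cn cn'] := (ltn_ord c, ltn_ord c').
case: lex => [lt|[e [lt|[e' lt]]]].
(* The three segments hold [a, b] but only [a']; then [a', b'] but only [b]; then [b, c] but only
   [b']. *)
- by exists 0, b'; split; lia.
- by exists a.+1, b.+1; split; lia.
- by exists b, c.+1; split; lia.
Qed.

Lemma injective_segment n : injective_system (segment_system n).
Proof.
apply/injective_systemP => Y Y' cY cY' neY.
suff [i [j [ij sep]]] : exists i j : 'I_n, i < j /\
    (1 < #|segment i j :&: Y|) != (1 < #|segment i j :&: Y'|).
  by have [S SSS aS] := segment_split ij; exists S, (segment i j).
have [a [b [c [ab bc eY]]]] := sorted_set3 cY.
have [a' [b' [c' [ab' bc' eY']]]] := sorted_set3 cY'.
rewrite {}eY {}eY' in neY *.
have neq : ~ (a = a' :> nat /\ b = b' :> nat /\ c = c' :> nat).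
  by case=> /val_inj ea [/val_inj eb /val_inj ec]; rewrite ea eb ec eqxx in neY.
have [lex|lex] :
    (b < b' \/ b = b' :> nat /\ (a < a' \/ a = a' :> nat /\ c < c')) \/
    (b' < b \/ b' = b :> nat /\ (a' < a \/ a' = a :> nat /\ c' < c)) by lia.
  exact: segment_separates.
have [i [j [ij sep]]] := segment_separates ab' bc' ab bc lex.
by exists i, j; rewrite eq_sym.
Qed.

(** Segments sharing a left or a right end are nested; if one starts where the other stops, they are
    disjoint. *)
Lemma segment_incompat n (i j k l : 'I_n) S S' : i < j -> k < l ->
  segment i j \in parts S -> segment k l \in parts S' -> incompat S S' ->
  [/\ i != k, i != l, j != k & j != l].
Proof.
move=> ij kl aS aS'; rewrite (incompat_part aS aS').
case/and4P=> /set0Pn[x1 +] /set0Pn[x2 +] /set0Pn[x3 +] /set0Pn[x4 +].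
rewrite !inE -!val_eqE /=; split; lia.
Qed.

Lemma dim_segment n : dim (segment_system n) <= n %/ 2.
Proof.
apply: dim_leq => I /subsetP ISS /incompat_setP inI.
have [|lo loP] := @fin_all_exists _ (fun=> 'I_n)
  (fun (S : {S | S \in I}) i => exists j : 'I_n, i < j /\ segment i j \in parts (val S)).
  by move=> S; have /segment_systemP := ISS _ (valP S).
have {loP}[hi loP] := fin_all_exists loP.
(* The two ends of each member of [I] give [2 * #|I|] distinct elements of ['I_n]. *)
pose f (u : {S | S \in I} * bool) := if u.2 then hi u.1 else lo u.1.
have injf : injective f.
  move=> [S s] [S' s']; rewrite /f /= => e.
  have [ij aS] := loP S; have [kl aS'] := loP S'.
  case: (eqVneq S S') => [eS|neS].
    by move: e; rewrite -eS; case: s; case: s' => // e; rewrite e ltnn in ij.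
  have := inI _ _ (valP S) (valP S') neS.
  case/(segment_incompat ij kl aS aS').
  by case: s e; case: s' => ->; rewrite eqxx.
have := leq_card f injf.
by rewrite card_prod card_bool card_ord card_sig leq_divRL.
Qed.

(** * Bounds on [ID] from explicit systems and from the search *)

Lemma ID_leq n (SS : {set bipart 'I_n}) d :
  split_system SS -> injective_system SS -> dim SS <= d -> ID n <= d.
Proof.
move=> sys inj le; rewrite /ID; case: ex_minnP => k _ min.
by apply: leq_trans le; apply: min; apply/asboolP; exists SS.
Qed.

Lemma leq_ID n d :
  (forall SS : {set bipart 'I_n}, split_system SS -> injective_system SS -> d <= dim SS) ->
  d <= ID n.
Proof.
by move=> h; rewrite /ID; case: ex_minnP => k /asboolP[SS [sys inj <-]] _; apply: h.
Qed.

Lemma ID_leq_half n : ID n <= n %/ 2.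
Proof. exact: ID_leq (@split_system_segment n) (@injective_segment n) (dim_segment n). Qed.

Lemma ltn_ID d m n : m < n ->
  refute d (quartets m.+1) [::] [seq true :: b | b <- bitseqs m] -> d < ID n.
Proof.
case: n => // n; rewrite ltnS => mn ref; apply: leq_ID => SS _ inj.
(* Only indices up to [m], hence below [n.+1], are used, so the default value of [inord] never
   occurs. *)
pose f i : 'I_n.+1 := inord i.
apply: (@refute_dim _ _ _ m (f 0) [seq f i | i <- iota 1 m]) ref => //; last first.
  by rewrite size_map size_iota.
rewrite -[f 0 :: _]/[seq f i | i <- iota 0 m.+1] map_inj_in_uniq ?iota_uniq //.
move=> i j; rewrite !mem_iota !add0n => /= im jm /(congr1 (@nat_of_ord _)).
by rewrite /f !inordK; lia.
Qed.

(** Both parameters of the search are one less than what they stand for: [1 3] asks for two crossing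
    codes on four points, and [2 5] below for three on six. *)
Lemma ID_gt1 n : 4 <= n -> 1 < ID n.
Proof. by move=> n4; apply: (@ltn_ID 1 3). Qed.

Lemma ID_gt2 n : 6 <= n -> 2 < ID n.
Proof. by move=> n6; apply: (@ltn_ID 2 5) => //; vm_compute. Qed.

(** * Eight points *)

(* Found by computer search among the systems invariant under the Klein four
   group generated by (01)(23)(45)(67) and (02)(13)(46)(57). *)
Definition subsets8 : seq (seq nat) :=
  [seq [:: i] | i <- iota 0 8] ++
  [:: [:: 0; 1]; [:: 2; 3]; [:: 5; 6]; [:: 4; 7];
   [:: 0; 4]; [:: 1; 5]; [:: 2; 6]; [:: 3; 7];
   [:: 1; 4]; [:: 0; 5]; [:: 3; 6]; [:: 2; 7];
   [:: 0; 1; 2; 3]; [:: 1; 3; 4; 6]; [:: 1; 2; 5; 6]].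

Definition codes8 : seq bitseq :=
  [seq [seq i \in s | i <- iota 0 8] | s <- subsets8].

Definition system8 : {set bipart 'I_8} :=
  [set S | [exists A in parts S, code (enum 'I_8) A \in codes8]].

Lemma size_code (T : finType) (xs : seq T) A : size (code xs A) = size xs.
Proof. exact: size_map. Qed.

Lemma count_code (T : finType) (A B : {set T}) :
  count (fun u => u.1 && u.2) (zip (code (enum T) A) (code (enum T) B)) = #|A :&: B|.
Proof.
rewrite zip_map count_map cardE size_filter -enumT.
by apply: eq_count => x /=; rewrite inE.
Qed.

Lemma code_inj (T : finType) : injective (@code T (enum T)).
Proof.
by move=> A B /eq_in_map e; apply/setP => x; apply: e; rewrite mem_enum.
Qed.

Lemma count_id_code (T : finType) (A : {set T}) : count id (code (enum T) A) = #|A|.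
Proof. by rewrite count_map cardE size_filter -enumT; apply: eq_count. Qed.

Lemma split_system8 : split_system system8.
Proof.
apply/forallP => S; apply/implyP => /exists_inP[A AS /cards1P[x eA]].
rewrite {}eA in AS; rewrite inE; apply/exists_inP; exists [set x] => //.
have -> : code (enum 'I_8) [set x] = [seq i \in [:: val x] | i <- iota 0 8].
  by rewrite -val_enum_ord -map_comp; apply: eq_map => i; rewrite /= !inE.
rewrite /codes8 map_cat mem_cat -map_comp.
by apply/orP; left; apply: (map_f (fun j => [seq i \in [:: j] | i <- iota 0 8])); rewrite mem_iota /=.
Qed.

Lemma dim_system8 : dim system8 <= 3.
Proof.
apply: dim_leq => I /subsetP ISS /incompat_setP inI.
have [|half halfP] := @fin_all_exists _ (fun=> {set 'I_8})
  (fun S A => S \in I -> A \in parts S /\ code (enum 'I_8) A \in codes8).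
  move=> S; case SI: (S \in I); last by exists set0.
  by have := ISS _ SI; rewrite inE => /exists_inP[A AS cA]; exists A.
(* Four pairwise incompatible splits would give four pairwise crossing codes in [codes8], which
   computation excludes. *)
rewrite leqNgt; apply/negP => gtI.
suff : has_clique 4 codes8 by vm_compute.
apply/has_cliqueP; exists [seq code (enum 'I_8) (half s) | s <- take 4 (enum I)].
have sub S : S \in take 4 (enum I) -> S \in I by move/mem_take; rewrite mem_enum.
split; first by rewrite size_map size_takel // -cardE.
  by move=> _ /mapP[S /sub/halfP[_ ?] ->].
rewrite pairwise_map.
have uI : uniq (take 4 (enum I)) by rewrite take_uniq ?enum_uniq.
rewrite uniq_pairwise in uI.
apply: (sub_in_pairwise (P := mem I)) uI; last by apply/allP => S /sub.
move=> S S' SI SI' /= ne; have [AS _] := halfP _ SI; have [AS' _] := halfP _ SI'.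
by apply: incompat_cross AS AS' _; apply: inI.
Qed.

Definition meets2 (b y : bitseq) : bool := 1 < count (fun u => u.1 && u.2) (zip b y).

(** A finite check over all pairs among the 56 codes of 3-sets. *)
Lemma separates8 :
  let ts := [seq y <- bitseqs 8 | count id y == 3] in
  all (fun y => all (fun y' =>
    (y == y') || has (fun b => meets2 b y != meets2 b y') codes8) ts) ts.
Proof. by vm_compute. Qed.

(** This lets a code be turned back into a split with two non-empty parts. *)
Lemma codes8_proper :
  all (fun b : bitseq => [&& size b == 8, true \in b & false \in b]) codes8.
Proof. by []. Qed.

Lemma injective_system8 : injective_system system8.
Proof.
apply/injective_systemP => Y Y' cY cY' neY.
have in3 (Z : {set 'I_8}) : #|Z| = 3 ->
    code (enum 'I_8) Z \in [seq y <- bitseqs 8 | count id y == 3].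
  move=> cZ; have := mem_bitseqs (code (enum 'I_8) Z).
  rewrite size_code size_enum_ord mem_filter => ->.
  by rewrite count_id_code cZ.
have /allP/(_ _ (in3 _ cY))/allP/(_ _ (in3 _ cY')) := separates8.
case/orP=> [/eqP e|/hasP[b b8]].
  by rewrite (code_inj e) eqxx in neY.
have code_set : code (enum 'I_8) [set x : 'I_8 | nth false b x] = b.
  have /allP/(_ b b8)/and3P[/eqP sb _ _] := codes8_proper.
  apply: (@eq_from_nth _ false); first by rewrite size_code size_enum_ord sb.
  move=> i; rewrite size_code size_enum_ord => i8.
  by rewrite (nth_map ord0) ?size_enum_ord // inE nth_enum_ord.
have /allP/(_ b b8)/and3P[_ tb fb] := codes8_proper.
rewrite -code_set in tb fb b8 *; rewrite /meets2 !count_code => sep.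
set A := [set x : 'I_8 | _] in tb fb b8 sep.
have [||S eS] := @mk_bipart _ A.
- by case/mapP: tb => x _ xA; apply/set0Pn; exists x.
- by case/mapP: fb => x _ xA; apply/set0Pn; exists x; rewrite inE -xA.
have AS : A \in parts S by rewrite eS !inE eqxx.
by exists S, A; split=> //; rewrite inE; apply/exists_inP; exists A.
Qed.

Theorem theorem3 :
  (forall n : nat, 4 <= n -> ID n <= n %/ 2) /\
  ID 3 = 1 /\
  (ID 4 = 2 /\ ID 5 = 2) /\
  (ID 6 = 3 /\ ID 7 = 3 /\ ID 8 = 3) /\
  (forall n : nat, 9 <= n -> 3 <= ID n).
Proof.
have eqID n k : ID n <= k -> k <= ID n -> ID n = k.
  by move=> le ge; apply/eqP; rewrite eqn_leq le.
split; first by move=> n _; apply: ID_leq_half.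
split; last split; last split.
(* Here [3 %/ 2] is 1, and the graph of any split system on three points has an edge. *)
- apply: eqID (ID_leq_half 3) _; apply: leq_ID => SS sys _.
  by apply: dim_gt0 sys _; rewrite card_ord.
- by split; [apply: eqID (ID_leq_half 4) _|apply: eqID (ID_leq_half 5) _]; apply: ID_gt1.
- split; [|split].
  + by apply: eqID (ID_leq_half 6) _; apply: ID_gt2.
  + by apply: eqID (ID_leq_half 7) _; apply: ID_gt2.
  (* The segments would only give 4 here, hence the explicit system. *)
  + by apply: eqID (ID_leq split_system8 injective_system8 dim_system8) _; apply: ID_gt2.
- by move=> n n9; apply: ID_gt2; apply: leq_trans n9.
Qed.
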